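(* Let $\mathbb{F}_\ell$ be a finite field, let $n\ge 1$ be an integer, and let $\mathbf{N}\subset \mathfrak{gl}_n$ be the nilpotent cone over $\mathbb{F}_\ell$. There is a constant $C_0$ such that for every $m\in\mathbb{N}$ $$\dim \mathcal{J}_m(\mathbf{N})<m\dim(\mathbf{N})+C_0 .$$
   Context: All varieties (reduced schemes of finite type over a field) are over $\mathbb{F}_\ell$. $\mathfrak{gl}_n$ is the variety of $n\times n$ matrices, and $\mathbf{N}$ is the closed subvariety of nilpotent matrices. For a scheme $\mathbf{X}$ of finite type, $\mathcal{J}_m(\mathbf{X})$ denotes its $m$-th jet scheme (the scheme representing $A\mapsto \mathbf{X}(A[t]/(t^{m+1}))$). *)

(* Defs.v *)
From HB Require Import structures.
From mathcomp Require Import all_boot all_order all_algebra.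
From mathcomp Require Import ring_quotient.
From mathcomp Require Import mpoly.

Set Implicit Arguments.
Unset Strict Implicit.
Unset Printing Implicit Defensive.

Import GRing.Theory.
Local Open Scope ring_scope.

(* A closed subscheme of the affine space A^N over k is given by its ideal,
   a subset of {mpoly k[N]}; its dimension is the Krull dimension of the
   quotient of {mpoly k[N]} by that ideal. *)

Definition is_prime_ideal (R : nzRingType) (P : {pred R}) : Prop :=
  idealr_closed P /\ prime_idealr_closed P.

(* P 0 < P 1 < ... < P d, strict inclusions of primes containing I.  Primes are
   boolean predicates, as in ring_quotient; classically, this is no
   restriction. *)
Definition prime_chain (R : nzRingType) (I : R -> Prop) (d : nat)
    (P : nat -> {pred R}) : Prop :=
  [/\ forall i, (i <= d)%N -> is_prime_ideal (P i),
      forall i f, (i <= d)%N -> I f -> f \in P i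
    & forall i, (i < d)%N ->
        {subset P i <= P i.+1} /\ exists2 f, f \in P i.+1 & f \notin P i].

(* The Krull dimension of R / I exists and equals d. *)
Definition has_krull_dim (R : nzRingType) (I : R -> Prop) (d : nat) : Prop :=
  (exists P, prime_chain I d P) /\
  (forall e P, prime_chain I e P -> (e <= d)%N).

Lemma has_krull_dim_uniq (R : nzRingType) (I : R -> Prop) (d e : nat) :
  has_krull_dim I d -> has_krull_dim I e -> d = e.
Proof.
move=> [[P cP] maxd] [[Q cQ] maxe]; apply/eqP.
by rewrite eqn_leq (maxe _ _ cP) (maxd _ _ cQ).
Qed.

Definition ideal_gen (R : comNzRingType) (E : R -> Prop) (g : R) : Prop :=
  exists s : seq (R * R),
    (forall c, c \in s -> E c.2) /\ g = \sum_(c <- s) c.1 * c.2.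

(* For a point with coordinates v (i, s) in A, the tuple of truncated arcs
   x_i(t) = \sum_(s <= m) v (i, s) t^s. *)
Definition jet_arc (A : nzRingType) (N m : nat) (v : 'I_(N * m.+1) -> A)
    (i : 'I_N) : {poly A} :=
  \sum_(s < m.+1) (v (mxvec_index i s))%:P * 'X^s.

(* The ideal of J_m(X) for X = V(I): the universal truncated arc, whose
   coefficients are the variables, is substituted in each f in I, and the
   coefficients of t^0, ..., t^m of the result are the equations. *)
Definition jet_ideal (k : comNzRingType) (N : nat) (I : {mpoly k[N]} -> Prop)
    (m : nat) : {mpoly k[N * m.+1]} -> Prop :=
  ideal_gen (fun g => exists (f : {mpoly k[N]}) (s : nat),
    [/\ I f, (s <= m)%N
      & g = (mmap (polyC \o @mpolyC (N * m.+1) k)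
               (jet_arc (fun j => 'X_j)) f)`_s]).

Arguments jet_ideal {k N} I m g.

(* J_m(X) represents A |-> X(A[t]/(t^(m+1))) on k-algebras: a point v satisfies
   the equations of J_m(X) iff every f in I vanishes modulo t^(m+1) on the arcs
   given by v. *)
Lemma jet_idealP (k : comNzRingType) (N : nat) (I : {mpoly k[N]} -> Prop)
    (m : nat) (A : comNzRingType) (iota : {rmorphism k -> A})
    (v : 'I_(N * m.+1) -> A) :
  (forall g, jet_ideal I m g -> mmap iota v g = 0) <->
  (forall f, I f ->
     take_poly m.+1 (mmap (polyC \o iota) (jet_arc v) f) = 0).
Proof.
have ev f : map_poly (mmap iota v)
    (mmap (polyC \o @mpolyC (N * m.+1) k) (jet_arc (fun j => 'X_j)) f)
    = mmap (polyC \o iota) (jet_arc v) f.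
  rewrite [mmap _ (jet_arc _) f]/mmap rmorph_sum /=; apply: eq_bigr => M _.
  rewrite rmorphM /= map_polyC /= mmapC; congr (_ * _).
  rewrite /mmap1 rmorph_prod; apply: eq_bigr => i _.
  rewrite rmorphXn /= /jet_arc raddf_sum /=; congr (_ ^+ _).
  apply: eq_bigr => s _.
  by rewrite rmorphM /= map_polyC /= map_polyXn mmapX mmap1U.
split=> [vJ f If | vI g [s [sE ->]]].
  apply/polyP => i; rewrite coef_take_poly coef0; case: ltnP => // lt_im.
  rewrite -ev coef_map; apply: vJ.
  exists [:: (1, (mmap (polyC \o @mpolyC (N * m.+1) k)
                    (jet_arc (fun j => 'X_j)) f)`_i)].
  split=> [c|]; last by rewrite big_seq1 mul1r.
  by rewrite inE => /eqP-> /=; exists f, i.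
rewrite rmorph_sum big_seq /=; apply: big1 => c /sE [f [i [If le_im eq_c]]].
rewrite rmorphM /= eq_c -coef_map ev.
have /(congr1 (fun p : {poly A} => p`_i)) := vI f If.
by rewrite coef_take_poly coef0 ltnS le_im => ->; rewrite mulr0.
Qed.

(* The ideal of the nilpotent cone in gl_n, which is a reduced scheme: the
   polynomials in the n^2 matrix entries that vanish at all nilpotent matrices
   over all extension fields of k.  The k-points alone would not do, since k is
   allowed to be finite. *)
Definition nilcone_ideal (k : fieldType) (n : nat) (f : {mpoly k[n * n]}) :
    Prop :=
  forall (K : fieldType) (iota : {rmorphism k -> K}) (A : 'M[K]_n),
    (exists r : nat, A ^+ r = 0) -> mmap iota (fun l => mxvec A 0 l) f = 0.

(* Main.v *)
(* Both bounds compare with n(n-1).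

   Upper bound.  A chain of e primes above P_0 yields e elements algebraically
   independent modulo P_0, so e is at most the number of generators over k of a
   field containing the generic point of V(P_0).  Such a point of J_m(N) is a
   matrix A over R = K[t]/(t^M), M = m + 1, with characteristic polynomial X^n.
   Conjugate A to Hessenberg form H with first basis vector fixed and
   subdiagonal entries t^(a_1), ..., t^(a_(n-1)).  Choosing the j-th new basis
   vector costs (n-j)(M - a_j) parameters and the upper triangle without the
   first row costs n(n-1)M/2.  The characteristic polynomial is affine in the
   first row of H; the equation chi = X^n determines its j-th entry up to the
   annihilator of t^(a_1 + ... + a_(j-1)), which costs at most
   a_1 + ... + a_(j-1) parameters.  The a_j cancel and the total is n(n-1)M.

   Lower bound.  The matrices g (0, w; 0, B) g^-1 with g = (1, 0; y, 1) and B
   recursively of the same form are nilpotent and depend on n(n-1) parameters;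
   setting these to 0 one after the other gives a strict chain of primes. *)
From HB Require Import structures.
Require Import Defs.
From Stdlib Require Import Classical ClassicalEpsilon.
From mathcomp Require Import all_boot all_order all_algebra.
From mathcomp Require Import generic_quotient ring_quotient fraction.
From mathcomp Require Import perm mpoly zify.

Set Implicit Arguments.
Unset Strict Implicit.
Unset Printing Implicit Defensive.

Import GRing.Theory.
Local Open Scope ring_scope.
Local Open Scope quotient_scope.

(** * Chains of primes and generators of the residue field *)

Section Quotient.

Variables (R : comNzRingType) (I : {pred R}).

Lemma ideal_quotient : idealr_closed I ->
  exists (Q : comNzRingType) (h : {rmorphism R -> Q}),
    (forall y, exists x, h x = y) /\ (forall x, h x = 0 <-> x \in I).
Proof.
move=> idI.
pose mI := isIdealr.Build R I idI.
pose J : idealr R := HB.pack I mI.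
exists {ideal_quot J}, \pi_{ideal_quot J}.
split=> [y|x]; first by exists (repr y); exact: reprK.
rewrite -(rmorph0 \pi_{ideal_quot J}).
split=> [/eqP|xI]; first by rewrite -Quotient.idealrBE subr0.
by apply/eqP; rewrite -Quotient.idealrBE subr0.
Qed.

End Quotient.

Section FractionField.

Variables (Q : comNzRingType).
Hypothesis domQ : forall x y : Q, x * y = 0 -> x = 0 \/ y = 0.

(** Excluded middle and choice supply the boolean unit predicate and the inverse function that an
    [idomainType] structure on Q requires. *)
Let is_inv (x : Q) := exists y, y * x = 1.
Let unitb (x : Q) : bool :=
  if excluded_middle_informative (is_inv x) then true else false.
Let inv (x : Q) : Q :=
  if excluded_middle_informative (is_inv x) is left e
  then proj1_sig (constructive_indefinite_description _ e) else x.

Let mulVx : {in unitb, left_inverse 1 inv *%R}.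
Proof.
move=> x; rewrite /in_mem /= /unitb /inv; case: excluded_middle_informative => // e _.
by case: constructive_indefinite_description.
Qed.

Let unitPx : forall x y, y * x = 1 -> unitb x.
Proof.
move=> x y yx; rewrite /unitb; case: excluded_middle_informative => // e.
by case: e; exists y.
Qed.

Let inv_out : {in [predC unitb], inv =1 id}.
Proof.
by move=> x; rewrite /in_mem /= /in_mem /= /unitb /inv; case: excluded_middle_informative.
Qed.

Lemma fraction_embedding :
  exists (K : fieldType) (h : {rmorphism Q -> K}), injective h.
Proof.
pose mU := GRing.ComNzRing_hasMulInverse.Build Q mulVx unitPx inv_out.
pose U : comUnitRingType := HB.pack Q mU.
have domU : GRing.integral_domain_axiom U.
  by move=> x y /domQ [] ->; rewrite eqxx ?orbT.
pose mD := GRing.ComUnitRing_isIntegral.Build U domU.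
pose D : idomainType := HB.pack (U : Type) U mD.
pose h : {rmorphism D -> {fraction D}} := @tofrac D.
exists {fraction D}, h => x y hxy; apply/(@eqP D).
by rewrite -(@tofrac_eq D); apply/eqP; exact: hxy.
Qed.

End FractionField.

(** K is the fraction field of R / P, the residue field at the generic point of V(P). *)
Lemma prime_ideal_field (R : comNzRingType) (P : {pred R}) : is_prime_ideal P ->
  exists (K : fieldType) (h : {rmorphism R -> K}), forall x, h x = 0 <-> x \in P.
Proof.
move=> [idP prP].
have [Q [g [gS gP]]] := ideal_quotient idP.
have domQ (x y : Q) : x * y = 0 -> x = 0 \/ y = 0.
  have [[a <-] [b <-]] := (gS x, gS y).
  by rewrite -rmorphM => /gP/prP/orP[/gP|/gP]; [left|right].
have [K [i i_inj]] := fraction_embedding domQ.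
exists K, (i \o g) => x /=; rewrite -gP; split=> [|->]; last by rewrite rmorph0.
by rewrite -(rmorph0 i) => /i_inj.
Qed.

Section PrimeIdeal.
Variables (R : comNzRingType) (P : {pred R}).
Hypothesis primeP : is_prime_ideal P.

Lemma prime_ideal0 : 0 \in P. Proof. by case: primeP => [[]]. Qed.
Lemma prime_ideal1 : 1 \notin P. Proof. by case: primeP => [[]]. Qed.
Lemma prime_idealMl a x : x \in P -> a * x \in P.
Proof. by case: primeP => [[P0 _ Pl] _] Px; rewrite -[_ * _]addr0 Pl. Qed.
Lemma prime_idealD x y : x \in P -> y \in P -> x + y \in P.
Proof. by case: primeP => [[_ _ Pl] _] Px Py; rewrite -[x]mul1r Pl. Qed.
Lemma prime_idealB x y : x \in P -> y \in P -> x - y \in P.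
Proof. by move=> Px Py; rewrite -mulN1r prime_idealD // prime_idealMl. Qed.
Lemma prime_ideal_sum (I : Type) (r : seq I) (Q : pred I) (F : I -> R) :
  (forall i, Q i -> F i \in P) -> \sum_(i <- r | Q i) F i \in P.
Proof.
by move=> FP; elim/big_rec: _ => [|i x /FP Fi xP]; [exact: prime_ideal0 | exact: prime_idealD].
Qed.
Lemma prime_idealXn x r : x \notin P -> x ^+ r \notin P.
Proof.
move=> xP; elim: r => [|r IHr]; first by rewrite expr0 prime_ideal1.
by rewrite exprS; apply/negP => /(proj2 primeP)/orP[]; apply/negP.
Qed.
End PrimeIdeal.

(** Nested pairs let an induction on e split off the exponent of [f 0]. *)
Fixpoint box (T e : nat) : finType :=
  if e is e'.+1 then ('I_T * box T e')%type : finType else unit.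

(* The monomial in f 0, ..., f e.-1 with exponents j, all less than T. *)
Fixpoint boxmon (R : comNzRingType) (T e : nat) (f : nat -> R) :
    box T e -> R :=
  match e return box T e -> R with
  | 0 => fun=> 1
  | e'.+1 => fun j => f 0%N ^+ j.1 * boxmon (fun i => f i.+1) j.2
  end.

Lemma card_box T e : #|box T e| = (T ^ e)%N.
Proof. by elim: e => [|e IHe]; rewrite ?card_unit // card_prod IHe card_ord expnS. Qed.

Section ChainIndependence.

Variables (k : fieldType) (R : comNzRingType) (c : {rmorphism k -> R}).

(** Order the relation by powers of [f 0]. Once the lower coefficients vanish, a power of [f 0],
    which lies outside [P 0], is divided out. Modulo [P 1], which contains [f 0], only the lowest
    remaining coefficient survives, and the induction hypothesis for the chain starting at [P 1]
    makes it vanish. *)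
Lemma prime_chain_boxmon_free e (P : nat -> {pred R}) (f : nat -> R) :
  (forall i, (i <= e)%N -> is_prime_ideal (P i)) ->
  (forall i, (i < e)%N -> {subset P i <= P i.+1}) ->
  (forall i, (i < e)%N -> f i \in P i.+1 /\ f i \notin P i) ->
  forall T (a : box T e -> k),
    \sum_j c (a j) * boxmon f j \in P 0%N -> forall j, a j = 0.
Proof.
elim: e P f => [|e IHe] P f prP subP fP T a.
  rewrite (big_pred1 tt) => [|[] //]; rewrite mulr1 => aP []; apply/eqP.
  apply: contraT => nz_a; have /negP[] := prime_ideal1 (prP 0%N isT).
  by rewrite -(rmorph1 c) -(mulVf nz_a) rmorphM (prime_idealMl (prP 0%N isT)).
have [pr0 pr1] := (prP 0%N isT, prP 1%N isT).
pose s (r : 'I_T) := \sum_(j : box T e) c (a (r, j)) * boxmon (fun i => f i.+1) j.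
have -> : \sum_j c (a j) * boxmon f j = \sum_(r < T) f 0%N ^+ r * s r.
  under [RHS]eq_bigr => r _ do rewrite big_distrr.
  rewrite pair_big; apply: eq_bigr => -[r j] _ /=.
  by rewrite mulrCA.
have [f1 f0] := fP 0%N isT.
move=> sP; suff s0 n (ltnT : (n < T)%N) : forall j, a (Ordinal ltnT, j) = 0.
  by case=> [[r ltrT] j]; apply: s0.
elim/ltn_ind: n ltnT => n IHn ltnT; set r := Ordinal ltnT.
have a0 (r' : 'I_T) : (r' < r)%N -> s r' = 0.
  case: r' => r' ltr'T lt_r; apply: big1 => j _.
  by rewrite (IHn r') // rmorph0 mul0r.
apply: (IHe (fun i => P i.+1) (fun i => f i.+1));
  [by move=> i; exact: (prP i.+1) | by move=> i; exact: (subP i.+1)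
  | by move=> i; exact: (fP i.+1)|].
(* The relation divided by [f 0 ^ r]; it is congruent to [s r] modulo [f 0]. *)
pose y := \sum_(i < T | (r <= i)%N) f 0%N ^+ (i - r) * s i.
have yP : y \in P 1%N.
  apply: subP => //; have /(proj2 pr0)/orP[fr|//] : f 0%N ^+ r * y \in P 0%N.
    move: sP; rewrite (bigID (fun i : 'I_T => (r <= i)%N)) /= [X in _ + X]big1.
      rewrite addr0; congr (_ \in P _); rewrite big_distrr /=; apply: eq_bigr => i le_ri.
      by rewrite mulrA -exprD subnKC.
    by move=> i; rewrite -ltnNge => /a0 ->; rewrite mulr0.
  by case/negP: (prime_idealXn pr0 r f0).
rewrite [X in X \in _](_ : _ = y - \sum_(i < T | (r < i)%N) f 0%N ^+ (i - r) * s i).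
  apply: prime_idealB => //; apply: prime_ideal_sum => // i lt_ri.
  rewrite mulrC (prime_idealMl pr1) // -[(i - r)%N]prednK ?subn_gt0 //.
  by rewrite exprS mulrC (prime_idealMl pr1).
rewrite /y (bigD1 r) //= subnn mul1r -addrA -[LHS]addr0; congr (_ + _).
apply/esym/eqP; rewrite subr_eq0; apply/eqP/eq_bigl => i.
by rewrite ltn_neqAle eq_sym andbC.
Qed.

End ChainIndependence.

(** The subfield generated by S over the image of k; the size of S bounds its transcendence degree.
    Since 0^-1 = 0, [gen_inv] takes no side condition. *)
Inductive gen (k K : fieldType) (iota : k -> K) (S : seq K) : K -> Prop :=
| gen_const c : gen iota S (iota c)
| gen_mem x : x \in S -> gen iota S x
| gen_add x y : gen iota S x -> gen iota S y -> gen iota S (x + y)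
| gen_mul x y : gen iota S x -> gen iota S y -> gen iota S (x * y)
| gen_opp x : gen iota S x -> gen iota S (- x)
| gen_inv x : gen iota S x -> gen iota S x^-1.

(** [msize] is the degree plus one; a bound of the form [_ <= a.+1] also covers the zero
    polynomial. *)
Lemma msizeM_leS (k : fieldType) N (p q : {mpoly k[N]}) a b :
  (msize p <= a.+1)%N -> (msize q <= b.+1)%N -> (msize (p * q) <= (a + b).+1)%N.
Proof.
have [->|p0] := eqVneq p 0; first by rewrite mul0r msize0.
have [->|q0] := eqVneq q 0; first by rewrite mulr0 msize0.
rewrite msizeM // => pa qb; have := leq_add pa qb.
by rewrite addSn addnS; case: (_ + _)%N => // s; rewrite ltnS.
Qed.

Lemma msizeXn_leS (k : fieldType) N (p : {mpoly k[N]}) a r :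
  (msize p <= a.+1)%N -> (msize (p ^+ r) <= (r * a).+1)%N.
Proof.
move=> pa; elim: r => [|r IHr]; first by rewrite expr0 msize1.
by rewrite exprS mulSn msizeM_leS.
Qed.

Lemma card_bmultinom N d : (#|{: 'X_{1..N < d.+1}}| <= d.+1 ^ N)%N.
Proof.
pose F (m : 'X_{1..N < d.+1}) : {ffun 'I_N -> 'I_d.+1} := [ffun i => inord (m i)].
have injF : injective F.
  move=> m1 m2 /ffunP eqF; apply/val_inj/mnmP => i.
  have lt_m (m : 'X_{1..N < d.+1}) : (m i < d.+1)%N.
    by apply: leq_ltn_trans (bmdeg m); rewrite mdegE (bigD1 i) //= leq_addr.
  by have := congr1 val (eqF i); rewrite !ffunE /= !inordK.
by have := leq_card F injF; rewrite card_ffun !card_ord.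
Qed.

(** The coefficient matrix has more rows than columns, so its left kernel is nonzero. *)
Lemma mpoly_dependent (k : fieldType) N d (J : finType) (p : J -> {mpoly k[N]}) :
  (forall j, (msize (p j) <= d.+1)%N) -> (d.+1 ^ N < #|J|)%N ->
  exists a : J -> k, (exists j, a j != 0) /\ \sum_j a j *: p j = 0.
Proof.
move=> sz ltJ.
pose B : 'M[k]_(#|J|, #|{: 'X_{1..N < d.+1}}|) :=
  \matrix_(i, l) (p (enum_val i))@_(bmnm (enum_val l)).
have : kermx B != 0.
  rewrite kermx_eq0 /row_free; apply: contraL ltJ => /eqP <-.
  by rewrite -leqNgt (leq_trans (rank_leq_col B)) ?card_bmultinom.
case/rowV0Pn => v /sub_kermxP vB v0.
exists (fun j => v 0 (enum_rank j)); split.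
  by case/rV0Pn: v0 => i vi; exists (enum_val i); rewrite enum_valK.
apply/mpolyP => m; rewrite mcoeff0 raddf_sum /=.
have [le_m|lt_m] := leqP d.+1 (mdeg m).
  apply: big1 => j _; rewrite mcoeffZ (memN_msupp_eq0 (msize_mdeg_ge _)) ?mulr0 //.
  exact: leq_trans (sz j) le_m.
have /rowP/(_ (enum_rank (BMultinom lt_m))) := vB.
rewrite !mxE => vB0; rewrite -[RHS]vB0 (reindex_onto enum_val enum_rank) /=.
  by apply: eq_big => [i|i _]; rewrite enum_valK ?eqxx // mxE mcoeffZ enum_rankK.
by move=> j _; rewrite enum_rankK.
Qed.

Section Generated.

Variables (k K : fieldType) (iota : {rmorphism k -> K}).

Local Notation ev S := (mmap iota (fun i : 'I_(size S) => S`_i)).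

Lemma gen_sub S S' x : (forall y, y \in S -> gen iota S' y) ->
  gen iota S x -> gen iota S' x.
Proof.
move=> SS'; elim=> {x} [c|x|x y _ Hx _ Hy|x y _ Hx _ Hy|x _ Hx|x _ Hx].
- exact: gen_const.
- exact: SS'.
- exact: gen_add.
- exact: gen_mul.
- exact: gen_opp.
- exact: gen_inv.
Qed.

Lemma gen_frac S x : gen iota S x ->
  exists u w, ev S w != 0 /\ x * ev S w = ev S u.
Proof.
elim=> {x} [c|x|x y _ [u [w [w0 xw]]] _ [u' [w' [w'0 yw']]]
  |x y _ [u [w [w0 xw]]] _ [u' [w' [w'0 yw']]]
  |x _ [u [w [w0 xw]]]|x _ [u [w [w0 xw]]]].
- by exists c%:MP, 1; rewrite rmorph1 mmapC oner_eq0 mulr1.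
- move=> xS; have ltx : (index x S < size S)%N by rewrite index_mem.
  exists 'X_(Ordinal ltx), 1; rewrite rmorph1 oner_eq0 mulr1 mmapX mmap1U /=.
  by rewrite nth_index.
- exists (u * w' + u' * w), (w * w'); rewrite rmorphD !rmorphM mulf_neq0 //.
  by split=> //=; rewrite -xw -yw' mulrDl mulrA; congr (_ + _); rewrite mulrCA mulrC.
- exists (u * u'), (w * w'); rewrite !rmorphM mulf_neq0 //.
  by split=> //=; rewrite -xw -yw' mulrACA.
- by exists (- u), w; rewrite rmorphN /= -xw mulNr.
(* Inversion swaps numerator and denominator, so x = 0 is treated apart. *)
have [->|x0] := eqVneq x 0; first by exists 0, w; rewrite invr0 mul0r rmorph0.
by exists w, u; rewrite -xw mulf_neq0 // mulKf.
Qed.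

Lemma gen_common_frac S e (y : nat -> K) : (forall i, (i < e)%N -> gen iota S (y i)) ->
  exists (w : {mpoly k[size S]}) (u : nat -> {mpoly k[size S]}), ev S w != 0 /\
    forall i, (i < e)%N -> y i * ev S w = ev S (u i).
Proof.
elim: e => [_|e IHe yS]; first by exists 1, (fun=> 0); rewrite rmorph1 oner_eq0.
have [i /ltnW/yS //|w [u [w0 yu]]] := IHe.
have [u' [w' [w'0 ye]]] := gen_frac (yS e (ltnSn e)).
exists (w * w'), (fun i => if i == e then u' * w else u i * w').
rewrite rmorphM mulf_neq0 //; split=> // i; rewrite ltnS leq_eqVlt.
case: eqP => [-> _|_ /= lt_ie] /=; rewrite rmorphM /=; first by rewrite -ye mulrCA mulrC.
by rewrite -yu // mulrA.
Qed.

(** Each factor y_i^r, with r < T, is brought to the denominator w^T; its numerator u_i^r w^(T - r)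
    has degree at most T d. *)
Lemma gen_boxmon S T d e (y : nat -> K) (w : {mpoly k[size S]})
    (u : nat -> {mpoly k[size S]}) :
  (msize w <= d.+1)%N -> (forall i, (i < e)%N -> (msize (u i) <= d.+1)%N) ->
  (forall i, (i < e)%N -> y i * ev S w = ev S (u i)) ->
  forall j : box T e, exists p : {mpoly k[size S]},
    (msize p <= (e * T * d).+1)%N /\ boxmon y j * ev S w ^+ (e * T) = ev S p.
Proof.
move=> szw; elim: e y u => [|e IHe] y u szu yu j.
  by exists 1; rewrite msize1 rmorph1 /= mulr1.
case: j => r j; have [p [szp jp]] := IHe (fun i => y i.+1) (fun i => u i.+1)
  (fun i => szu i.+1) (fun i => yu i.+1) j.
exists (u 0%N ^+ r * w ^+ (T - r) * p); split.
  have eqT : (e.+1 * T * d = r * d + (T - r) * d + e * T * d)%N.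
    by rewrite -mulnDl subnKC ?(ltnW (ltn_ord r)) // -mulnDl -mulSn.
  by rewrite eqT !msizeM_leS ?msizeXn_leS ?szu.
rewrite !rmorphM !rmorphXn /= -jp -yu // exprMn mulSn exprD.
rewrite -[in ev S w ^+ T](subnKC (ltnW (ltn_ord r))) exprD.
by rewrite -!mulrA; congr (_ * _); rewrite mulrCA; congr (_ * _); rewrite mulrCA.
Qed.

End Generated.

(** The chain yields e elements of the residue field of [P 0] that are algebraically independent
    over k; linear algebra in bounded degree shows that e cannot exceed the size of S. *)
Lemma prime_chain_gen_bound (k K : fieldType) (R : comNzRingType)
    (c : {rmorphism k -> R}) (h : {rmorphism R -> K}) (S : seq K) e
    (P : nat -> {pred R}) (I : R -> Prop) :
  prime_chain I e P -> (forall x, h x = 0 <-> x \in P 0%N) ->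
  (forall x, gen (h \o c) S (h x)) -> (e <= size S)%N.
Proof.
move=> [prP _ subP] kerh hS.
have [f fP] : exists f : nat -> R, forall i, (i < e)%N -> f i \in P i.+1 /\ f i \notin P i.
  elim: {prP} e subP => [|e IHe] subP; first by exists (fun=> 0).
  have [i /ltnW/subP //|f fP] := IHe; have [_ [g gP gnP]] := subP e (ltnSn e).
  exists (fun i => if i == e then g else f i) => i; rewrite ltnS leq_eqVlt.
  by case: eqP => [-> _ //|_ /= /fP].
have [w [u [w0 fu]]] := gen_common_frac (fun i (_ : (i < e)%N) => hS (f i)).
(* The T ^ e box monomials in f are independent, but times w ^ (e * T) they lie
   in the span of at most (e T d + 1) ^ |S| monomials in S: if e > |S| this
   fails for T large. *)
pose d := (msize w + \max_(i < e) msize (u i))%N.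
have szw : (msize w <= d.+1)%N by rewrite leqW ?leq_addr.
have szu i : (i < e)%N -> (msize (u i) <= d.+1)%N.
  move=> lt_ie; rewrite leqW // (leq_trans _ (leq_addl _ _)) //.
  exact: (leq_bigmax (F := fun i : 'I_e => msize (u i)) (Ordinal lt_ie)).
rewrite leqNgt; apply/negP => ltSe.
(* With s = |S|: (e T d + 1)^s <= ((e d + 1) T)^s < T^(s + 1) <= T^e, the strict step because T > (e
   d + 1)^s. *)
pose T := ((e * d).+1 ^ size S).+1.
have [p pP] := fin_all_exists (gen_boxmon (T := T) szw szu fu).
have ltJ : ((e * T * d).+1 ^ size S < #|box T e|)%N.
  rewrite card_box (@leq_trans (T ^ (size S).+1)) //; last exact: leq_pexp2l.
  rewrite expnS; apply: leq_ltn_trans (_ : ((e * d).+1 * T) ^ size S < _)%N.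
    case: (size S) => // s; rewrite leq_exp2r // mulSn mulnAC -add1n leq_add2r //.
  by rewrite expnMn ltn_mul2r expn_gt0 /= ltnS.
have [a [[j aj] ap]] := mpoly_dependent (fun j => (pP j).1) ltJ.
case/eqP: aj; apply: (prime_chain_boxmon_free (c := c) (P := P) (f := f)) => //.
  by move=> i /subP[].
apply/kerh; apply/eqP; rewrite -(mulIr_eq0 _ (mulIf (expf_neq0 (e * T) w0))).
rewrite rmorph_sum mulr_suml.
have hb T' e' g (i : box T' e') : h (boxmon g i) = boxmon (h \o g) i.
  by elim: e' g i => [|e' IHe] g i; rewrite ?rmorph1 //= rmorphM rmorphXn IHe.
move/(congr1 (mmap (h \o c) (fun i : 'I_(size S) => S`_i))): ap.
rewrite rmorph0 rmorph_sum /= => ap; rewrite -[X in _ == X]ap; apply/eqP.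
by apply: eq_bigr => i _; rewrite mmapZ rmorphM hb -mulrA (pP i).2.
Qed.

(** * Parameter count for matrices over truncated power series *)

(** The ring K[t]/(t^M), accessed below only through h, its surjectivity and its kernel; M > 0 keeps
    1 out of the ideal. *)
Lemma truncated_poly_ring (K : fieldType) (M : nat) : (0 < M)%N ->
  exists (R : comNzRingType) (h : {rmorphism {poly K} -> R}),
    (forall x, exists p, h p = x) /\
    (forall p, h p = 0 <-> forall i, (i < M)%N -> p`_i = 0).
Proof.
move=> M0; pose I : {pred {poly K}} := [pred p : {poly K} | take_poly M p == 0].
have IP p : p \in I <-> forall i, (i < M)%N -> p`_i = 0.
  split=> [/eqP/polyP pI i lt_iM|pI].
    by have := pI i; rewrite coef_take_poly lt_iM coef0.
  by apply/eqP/polyP => i; rewrite coef_take_poly coef0; case: ifP => // /pI.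
have idI : idealr_closed I.
  split; first by apply/IP => i _; rewrite coef0.
    apply/negP => /IP/(_ 0%N M0); rewrite coefC eqxx => /eqP; exact/negP/oner_neq0.
  move=> a p q /IP pI /IP qI; apply/IP => i lt_iM.
  rewrite coefD qI // addr0 coefM big1 // => j _.
  by rewrite pI ?mulr0 // (leq_ltn_trans (leq_subr _ _)).
have [R [h [hS hI]]] := ideal_quotient idI.
by exists R, h; split=> // p; rewrite hI.
Qed.

Section GenField.

Variables (k K : fieldType) (iota : {rmorphism k -> K}).
Implicit Types S : seq K.

Lemma gen0 S : gen iota S 0.
Proof. by rewrite -(rmorph0 iota); apply: gen_const. Qed.
Lemma gen1 S : gen iota S 1.
Proof. by rewrite -(rmorph1 iota); apply: gen_const. Qed.
Lemma gen_sum S (I : Type) (r : seq I) (Q : pred I) (F : I -> K) :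
  (forall i, Q i -> gen iota S (F i)) -> gen iota S (\sum_(i <- r | Q i) F i).
Proof. by move=> FG; elim/big_ind: _ => //; [exact: gen0 | exact: gen_add]. Qed.

End GenField.

(** * Truncated power series with coefficients in a subfield *)

Section TruncatedSeries.

Variables (k K : fieldType) (iota : {rmorphism k -> K}) (M : nat).
Variables (R : comNzRingType) (h : {rmorphism {poly K} -> R}).
Hypothesis h_surj : forall x, exists p, h p = x.
Hypothesis h_ker : forall p, h p = 0 <-> forall i, (i < M)%N -> p`_i = 0.
Implicit Types S : seq K.

Local Notation G := (gen iota).
Local Notation t := (h 'X).

(* R stands for K[t]/(t^M): some representative of x has its coefficients in
   the subfield of K generated by S. *)
Definition defover S (x : R) := exists p : {poly K}, (forall i, G S p`_i) /\ h p = x.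

Lemma h_eq p q : h p = h q <-> forall i, (i < M)%N -> p`_i = q`_i.
Proof.
split=> [/eqP|epq].
  rewrite -subr_eq0 -rmorphB => /eqP/h_ker epq i /epq /eqP.
  by rewrite coefB subr_eq0 => /eqP.
apply/eqP; rewrite -subr_eq0 -rmorphB; apply/eqP/h_ker => i /epq.
by rewrite coefB => ->; rewrite subrr.
Qed.

Lemma defover_sub S S' x : {subset S <= S'} -> defover S x -> defover S' x.
Proof.
move=> SS' [p [pS <-]]; exists p; split=> // i; apply: gen_sub (pS i) => y /SS'.
exact: gen_mem.
Qed.

Lemma defover0 S : defover S 0.
Proof. by exists 0; split=> [i|]; rewrite ?rmorph0 // coef0; apply: gen0. Qed.
Lemma defover1 S : defover S 1.
Proof.
exists 1; split=> [i|]; rewrite ?rmorph1 // coef1; case: eqP => _; [exact: gen1|exact: gen0].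
Qed.
Lemma defovert S : defover S t.
Proof.
exists 'X; split=> // i; rewrite coefX; case: eqP => _; [exact: gen1|exact: gen0].
Qed.
Lemma defoverD S x y : defover S x -> defover S y -> defover S (x + y).
Proof.
move=> [p [pS <-]] [q [qS <-]]; exists (p + q); split=> [i|]; last exact: rmorphD.
by rewrite coefD; apply: gen_add.
Qed.
Lemma defoverN S x : defover S x -> defover S (- x).
Proof.
move=> [p [pS <-]]; exists (- p); split=> [i|]; last exact: rmorphN.
by rewrite coefN; apply: gen_opp.
Qed.
Lemma defoverB S x y : defover S x -> defover S y -> defover S (x - y).
Proof. by move=> xS yS; apply/defoverD/defoverN. Qed.
Lemma defoverM S x y : defover S x -> defover S y -> defover S (x * y).
Proof.
move=> [p [pS <-]] [q [qS <-]]; exists (p * q); split=> [i|]; last exact: rmorphM.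
by rewrite coefM; apply: gen_sum => j _; apply: gen_mul.
Qed.
Lemma defover_sum S (I : Type) (r : seq I) (Q : pred I) (F : I -> R) :
  (forall i, Q i -> defover S (F i)) -> defover S (\sum_(i <- r | Q i) F i).
Proof. by move=> FS; elim/big_ind: _ => //; [exact: defover0 | exact: defoverD]. Qed.
Lemma defoverXn S x n : defover S x -> defover S (x ^+ n).
Proof.
by move=> xS; elim: n => [|n IHn]; rewrite ?exprS; [exact: defover1|exact: defoverM].
Qed.

Lemma defover_coef S (p : {poly K}) i : defover S (h p) -> (i < M)%N -> G S p`_i.
Proof. by move=> [q [qS /h_eq epq]] lt_iM; rewrite -epq. Qed.

Lemma defover_of_coef S (p : {poly K}) : (forall i, (i < M)%N -> G S p`_i) -> defover S (h p).
Proof.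
move=> pS; exists (take_poly M p); split=> [i|].
  by rewrite coef_take_poly; case: ifP => [/pS //|_]; apply: gen0.
by apply/h_eq => i lt_iM; rewrite coef_take_poly lt_iM.
Qed.

Lemma t_nilpotent : t ^+ M = 0.
Proof.
by rewrite -rmorphXn; apply/h_ker => i lt_iM; rewrite coefXn (ltn_eqF lt_iM).
Qed.

(** Put q = 1 - p / p_0. Its constant term is 0, so [h q] is nilpotent and a finite geometric series
    inverts 1 - q = p / p_0 over the same subfield. *)
Lemma defover_inv S (p : {poly K}) : defover S (h p) -> (0 < M)%N -> p`_0 != 0 ->
  exists2 y, defover S y & y * h p = 1.
Proof.
move=> pS M0 p0; pose q := 1 - (p`_0)^-1 *: p.
have q0 : q`_0 = 0 by rewrite coefB coefZ coef1 eqxx mulVf // subrr.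
have def_polyC c : G S c -> defover S (h c%:P).
  by move=> cS; exists c%:P; split=> // i; rewrite coefC; case: eqP => // _; apply: gen0.
have c0S : defover S (h ((p`_0)^-1)%:P) by apply/def_polyC/gen_inv/defover_coef.
have qS : defover S (h q).
  rewrite rmorphB rmorph1 -mul_polyC rmorphM.
  by apply/defoverB/defoverM => //; apply: defover1.
have qM : h q ^+ M = 0.
  have [r ->] : exists r, q = r * 'X.
    exists (drop_poly 1 q); apply/polyP => i; rewrite coefMX coef_drop_poly.
    by case: i => // i; rewrite addn1.
  by rewrite rmorphM exprMn t_nilpotent mulr0.
exists (h ((p`_0)^-1)%:P * \sum_(i < M) h q ^+ i).
  by apply: defoverM => //; apply: defover_sum => i _; apply: defoverXn.
rewrite mulrAC -rmorphM mul_polyC; have -> : h ((p`_0)^-1 *: p) = 1 - h q.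
  by rewrite -(rmorph1 h) -rmorphB subKr.
by rewrite -[1 - _]opprB mulNr -subrX1 qM sub0r opprK.
Qed.

(** Multiplication by t^e loses only the top e coefficients of x; these form S'. If e > M, then
    [M - e] is 0 and S' covers all of them. *)
Lemma defover_divXn S e x : defover S (t ^+ e * x) ->
  exists2 S', (size S' <= e)%N & defover (S ++ S') x.
Proof.
have [p <-] := h_surj x; rewrite -rmorphXn -rmorphM => pS.
exists [seq p`_i | i <- seq.iota (M - e)%N e]; first by rewrite size_map size_iota.
apply: defover_of_coef => i lt_iM; have [lt_i|le_i] := ltnP (i + e) M.
  have := defover_coef pS lt_i; rewrite coefXnM ltnNge leq_addl /= addnK.
  by apply: gen_sub => y yS; apply: gen_mem; rewrite mem_cat yS.
apply: gen_mem; rewrite mem_cat; apply/orP; right; apply/mapP; exists i => //.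
rewrite mem_iota leq_subLR addnC le_i /=; move: lt_iM le_i; lia.
Qed.

Lemma defover_small b (p : {poly K}) : (forall i, (b <= i)%N -> p`_i = 0) ->
  exists2 S, (size S <= b)%N & defover S (h p).
Proof.
move=> pb; exists (mkseq (fun i => p`_i) b); first by rewrite size_mkseq.
apply: defover_of_coef => i _; have [/pb ->|lt_ib] := leqP b i; first exact: gen0.
by apply: gen_mem; apply/mapP; exists i; rewrite // mem_iota.
Qed.

Lemma defover_collect (I : finType) (F : I -> R) b :
  (forall i, exists2 S, (size S <= b)%N & defover S (F i)) ->
  exists2 S, (size S <= #|I| * b)%N & forall i, defover S (F i).
Proof.
move=> HF; have [s sP] := fin_all_exists2 HF.
exists (flatten [seq s i | i <- enum I]); last first.
  move=> i; apply: defover_sub (_ : defover (s i) _); last by case: (sP i).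
  by move=> y ys; apply/flatten_mapP; exists i; rewrite ?mem_enum.
rewrite size_flatten /shape -map_comp sumnE big_map cardE mulnC.
elim: (enum I) => [|i r IHr]; first by rewrite big_nil.
by rewrite big_cons mulnS leq_add //; case: (sP i).
Qed.

Lemma defover_any x : exists2 S, (size S <= M)%N & defover S x.
Proof.
have [p <-] := h_surj x; have -> : h p = h (take_poly M p).
  by apply/h_eq => i lt_iM; rewrite coef_take_poly lt_iM.
by apply: defover_small => i le_Mi; rewrite coef_take_poly ltnNge le_Mi.
Qed.

(** The comparison takes place in [nat], so that n = 0 is allowed and gives the empty column. *)
Definition e1 (A : nzRingType) n : 'cV[A]_n := \col_i (i == 0%N :> nat)%:R.

(** The exponent a is the least valuation of an entry, capped at M. Division by t^a leaves M - a
    coefficients per entry, and an entry of least valuation becomes a unit. *)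
Lemma column_content n (u : 'cV[R]_n) : (0 < M)%N ->
  exists a S (w : 'cV[R]_n), [/\ (a <= M)%N, u = t ^+ a *: w,
    (size S <= n * (M - a))%N, forall i, defover S (w i 0)
  & (0 < n)%N -> exists i y, defover S y /\ y * w i 0 = 1].
Proof.
move=> M0; have [p pu] := fin_all_exists (fun i => h_surj (u i 0)).
pose ok a := (a <= M)%N && [forall i, [forall j : 'I_a, (p i)`_j == 0]].
have ok0 : exists a, ok a by exists 0%N; apply/forallP => i; apply/forallP => -[].
have okM a : ok a -> (a <= M)%N by case/andP.
case: (ex_maxnP ok0 okM) => a /andP[le_aM /forallP pa0] maxa.
have pa i j : (j < a)%N -> (p i)`_j = 0.
  by move=> lt_ja; have /forallP/(_ (Ordinal lt_ja))/eqP := pa0 i.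
move: le_aM; rewrite leq_eqVlt => /orP[/eqP eq_aM|lt_aM].
  (* Here u = 0 and no parameter may be spent; [e1] has a unit entry and costs none. *)
  exists M, [::], (e1 R n); split=> //.
  - rewrite t_nilpotent scale0r; apply/colP => i; rewrite mxE -pu.
    by apply/h_ker => j; rewrite -eq_aM; apply: pa.
  - by move=> i; rewrite mxE; case: eqP => _; [apply: defover1|apply: defover0].
  move=> n0; exists (Ordinal n0), 1; rewrite mxE /= mulr1; split=> //; exact: defover1.
(* Truncation at M makes the coefficients from M - a on vanish. *)
pose q i := drop_poly a (take_poly M (p i)).
have qE i j : (q i)`_j = if (j + a < M)%N then (p i)`_(j + a) else 0.
  by rewrite coef_drop_poly coef_take_poly.
have [S szS defS] : exists2 S, (size S <= #|'I_n| * (M - a))%N & forall i, defover S (h (q i)).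
  apply: defover_collect => i; apply: defover_small => j le_j; rewrite qE ifF //.
  by apply/negbTE; rewrite -leqNgt; lia.
have [i pi] : exists i, (p i)`_a != 0.
  apply/existsP; rewrite -[[exists _, _]]negbK negb_exists; apply/negP => /forallP pa0'.
  suff /maxa : ok a.+1 by rewrite ltnn.
  rewrite /ok lt_aM; apply/forallP => i; apply/forallP => -[j].
  rewrite /= ltnS leq_eqVlt => /orP[/eqP ->|lt_ja]; last by rewrite pa.
  by rewrite -[_ == _]negbK pa0'.
exists a, S, (\col_i h (q i)); split=> //; first exact: ltnW.
- apply/colP => j; rewrite !mxE -pu -rmorphXn -rmorphM; apply/h_eq => l lt_lM.
  rewrite coefXnM qE; case: ltnP => [lt_la|le_al]; first by rewrite pa.
  by rewrite subnK // lt_lM.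
- by rewrite card_ord in szS.
- by move=> j; rewrite mxE.
move=> _; exists i; have [|y yS yq] := defover_inv (defS i) M0; last by exists y; rewrite mxE.
by rewrite qE add0n lt_aM.
Qed.

End TruncatedSeries.

Lemma char_poly_conj (R : comNzRingType) n (P Q H : 'M[R]_n) :
  P *m Q = 1%:M -> char_poly (P *m H *m Q) = char_poly H.
Proof.
move=> PQ; rewrite /char_poly.
have -> : char_poly_mx (P *m H *m Q) = map_mx polyC P *m char_poly_mx H *m map_mx polyC Q.
  rewrite /char_poly_mx mulmxBr mulmxBl -!map_mxM mul_mx_scalar -scalemxAl -map_mxM PQ.
  by rewrite map_mx1 scalemx1.
by rewrite !det_mulmx mulrAC -det_mulmx -map_mxM PQ map_mx1 det1 mul1r.
Qed.

(** * Characteristic polynomials of bordered and Hessenberg matrices *)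

Section CyclicColumn.

Variable R : comNzRingType.

(** Through this vector the first row of a bordered matrix enters its characteristic polynomial. *)
Definition adj_e1 n (H : 'M[R]_n) : 'cV[{poly R}]_n :=
  \adj (char_poly_mx H) *m e1 _ n.

Lemma e1S (A : nzRingType) n : e1 A n.+1 = col_mx (1%:M : 'M_1) 0 :> 'cV_(1 + n).
Proof.
apply/colP => i; rewrite !mxE; case: splitP => j ->; rewrite !mxE ?ord1 //.
Qed.

Lemma map_e1 (A B : nzRingType) (f : {rmorphism A -> B}) n : map_mx f (e1 A n) = e1 B n.
Proof. by apply/colP => i; rewrite !mxE rmorph_nat. Qed.

(* With V = (chi_H, s adj_e1 H), the product char_poly_mx B *m V has a single
   nonzero entry p, the first one; comparing determinants gives char_poly B = p,
   hence V = adj_e1 B. *)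
Lemma hessenberg_char_poly n (al : 'M[R]_1) (rho : 'rV[R]_n) (s : R) (H : 'M[R]_n) :
  let B := block_mx al rho (s *: e1 R n) H : 'M_(1 + n) in
  char_poly B = ('X - (al 0 0)%:P) * char_poly H
                - s%:P * (map_mx polyC rho *m adj_e1 H) 0 0 /\
  adj_e1 B = col_mx (char_poly H)%:M (s%:P *: adj_e1 H) :> 'cV_(1 + n).
Proof.
move=> B; set p := (X in _ = X /\ _); pose V := col_mx (char_poly H)%:M (s%:P *: adj_e1 H).
have eqB : char_poly_mx B = block_mx ('X - (al 0 0)%:P)%:M (- map_mx polyC rho)
    (- (s%:P *: e1 _ n)) (char_poly_mx H).
  rewrite /char_poly_mx scalar_mx_block map_block_mx opp_block_mx add_block_mx !sub0r.
  congr block_mx; last by rewrite map_mxZ map_e1.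
  by rewrite [al in LHS]mx11_scalar map_scalar_mx -raddfB.
have BV : char_poly_mx B *m V = p *: (col_mx 1%:M 0 : 'cV_(1 + n)).
  rewrite eqB mul_block_col -!scalar_mxM !mulNmx -!scalemxAr -scalemxAl.
  rewrite mul_mx_scalar /adj_e1 [char_poly_mx H *m _]mulmxA mul_mx_adj mul_scalar_mx.
  rewrite -/(char_poly H) addNr.
  rewrite scale_col_mx scaler0; congr col_mx.
  by rewrite [LHS]mx11_scalar [RHS]mx11_scalar /p /adj_e1 !mxE eqxx mulr1.
have pE : char_poly B = p.
  (* The determinant of W is chi_H, which is monic and can be cancelled. *)
  pose W := block_mx (char_poly H)%:M 0 (s%:P *: adj_e1 H) 1%:M : 'M_(1 + n).
  have : char_poly_mx B *m W = block_mx p%:M (- map_mx polyC rho) 0 (char_poly_mx H).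
    rewrite [W]block_mxEh mul_mx_row -/V BV eqB mul_block_col !mulmx0 !mulmx1 !add0r.
    by rewrite block_mxEh scale_col_mx scaler0 scale_scalar_mx mulr1.
  move/(congr1 determinant); rewrite det_mulmx det_ublock det_lblock !det_scalar1 det1 mulr1.
  exact: (monic_rreg (char_poly_monic H)).
have BKV : char_poly B *: adj_e1 B = char_poly B *: V.
  by rewrite -[RHS]mul_scalar_mx -mul_adj_mx -mulmxA BV /adj_e1 -scalemxAr pE e1S.
split=> //; apply/colP => i; apply: (monic_lreg (char_poly_monic B)).
by have /colP/(_ i) := BKV; rewrite [LHS]mxE [RHS]mxE.
Qed.

(* Hessenberg matrices with subdiagonal entries t^(a_1), ..., t^(a_(n-1)), where
   b is the sum of the (n - j) a_j, the codimension of this form and at the same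
   time the cost of the first row. *)
Fixpoint hess (t : R) n (b : nat) : 'M[R]_n -> Prop :=
  match n return 'M[R]_n -> Prop with
  | 0 => fun=> True
  | n'.+1 => fun H => exists a b' (al : 'M_1) rho (H' : 'M_n'),
      [/\ H = block_mx al rho (t ^+ a *: e1 R n') H' :> 'M_(1 + n'), hess t b' H'
        & b = (n' * a + b')%N]
  end.

(** The bound keeps these entries out of degree n, where only a monic [char_poly] factor then
    contributes. *)
Lemma size_adj_e1 t n b (H : 'M[R]_n) : hess t b H ->
  forall i, (size (adj_e1 H i ord0) <= n)%N.
Proof.
elim: n b H => [|n IHn] b H; first by move=> _ [].
case=> a [b' [al [rho [H' [-> /IHn szH' _]]]]] i.
have [_ ->] := hessenberg_char_poly al rho (t ^+ a) H'.
rewrite mxE; case: splitP => j _; first by rewrite ord1 mxE mulr1n size_char_poly.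
by rewrite mxE mul_polyC (leq_trans (size_scale_leq _ _)) // ltnW // ltnS szH'.
Qed.

End CyclicColumn.

(** * Parameter count for matrices with characteristic polynomial X^n *)

Section HessenbergCount.

Variables (k K : fieldType) (iota : {rmorphism k -> K}) (M : nat).
Variables (R : comNzRingType) (h : {rmorphism {poly K} -> R}).
Hypothesis M_gt0 : (0 < M)%N.
Hypothesis h_surj : forall x, exists p, h p = x.
Hypothesis h_ker : forall p, h p = 0 <-> forall i, (i < M)%N -> p`_i = 0.
Implicit Types S : seq K.

Local Notation t := (h 'X).
Local Notation def := (defover iota h).

Definition mxdef S m n (A : 'M[R]_(m, n)) := forall i j, def S (A i j).
Definition polydef S (p : {poly R}) := forall i, def S p`_i.

Lemma mxdef_sub S S' m n (A : 'M[R]_(m, n)) : {subset S <= S'} -> mxdef S A -> mxdef S' A.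
Proof. by move=> SS' AS i j; apply: defover_sub (AS i j). Qed.

Lemma mxdefM S m n p (A : 'M[R]_(m, n)) (B : 'M[R]_(n, p)) :
  mxdef S A -> mxdef S B -> mxdef S (A *m B).
Proof. by move=> AS BS i j; rewrite mxE; apply: defover_sum => l _; apply: defoverM. Qed.

Lemma mxdef_block S m1 m2 n1 n2 (A : 'M[R]_(m1, n1)) (B : 'M[R]_(m1, n2))
    (C : 'M[R]_(m2, n1)) (D : 'M[R]_(m2, n2)) :
  mxdef S A -> mxdef S B -> mxdef S C -> mxdef S D -> mxdef S (block_mx A B C D).
Proof.
by move=> AS BS CS DS i j; rewrite !mxE; case: splitP => i' _; rewrite mxE; case: splitP.
Qed.

Lemma mxdef0 S m n : mxdef S (0 : 'M_(m, n)).
Proof. by move=> i j; rewrite mxE; apply: defover0. Qed.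

Lemma mxdef1 S n : mxdef S (1%:M : 'M_n).
Proof. by move=> i j; rewrite mxE; case: eqP => _; [apply: defover1 | apply: defover0]. Qed.

Lemma polydefD S p q : polydef S p -> polydef S q -> polydef S (p + q).
Proof. by move=> pS qS i; rewrite coefD; apply: defoverD. Qed.
Lemma polydefN S p : polydef S p -> polydef S (- p).
Proof. by move=> pS i; rewrite coefN; apply: defoverN. Qed.
Lemma polydefM S p q : polydef S p -> polydef S q -> polydef S (p * q).
Proof. by move=> pS qS i; rewrite coefM; apply: defover_sum => j _; apply: defoverM. Qed.
Lemma polydefC S c : def S c -> polydef S c%:P.
Proof. by move=> cS i; rewrite coefC; case: eqP => // _; apply: defover0. Qed.
Lemma polydefXn S n : polydef S 'X^n.
Proof. by move=> i; rewrite coefXn; case: eqP => _; [apply: defover1 | apply: defover0]. Qed.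

Lemma polydef_char_poly S n (A : 'M[R]_n) : mxdef S A -> polydef S (char_poly A).
Proof.
move=> AS; rewrite /char_poly /determinant; elim/big_ind: _ => [|p q|s _].
- by apply: polydefC; apply: defover0.
- exact: polydefD.
have S1 : polydef S 1 by apply: polydefC; apply: defover1.
apply: polydefM.
  by case: (odd_perm s); rewrite ?expr1 ?expr0 //; apply: polydefN.
elim/big_ind: _ => [//|p q|i _]; first exact: polydefM.
rewrite !mxE; apply/polydefD/polydefN/polydefC/AS.
case: eqP => _; rewrite ?mulr1n ?mulr0n; first exact: (polydefXn S 1).
by apply: polydefC; apply: defover0.
Qed.

(** A transposition moves e1 to the basis vector e_i at a unit entry w_i. Then 1 + N with N = (w -
    e_i) e_i^T sends e_i to w; as N^2 = (w_i - 1) N, its inverse is 1 - y N with y = 1 / w_i. *)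
Lemma complete_column S n (w : 'cV[R]_n) : (forall i, def S (w i 0)) ->
  ((0 < n)%N -> exists i y, def S y /\ y * w i 0 = 1) ->
  exists V W : 'M[R]_n, [/\ V *m W = 1%:M, W *m V = 1%:M, V *m e1 R n = w,
    mxdef S V & mxdef S W].
Proof.
case: n w => [|n] w wS.
  move=> _; exists 1%:M, 1%:M; split; rewrite ?mulmx1 //; try exact: mxdef1.
  by apply/colP => -[].
case=> // i [y [yS yw]].
pose f : 'rV[R]_n.+1 := delta_mx 0 i; pose x := w - delta_mx i 0.
have fw : f *m w = (w i 0)%:M.
  by rewrite -rowE [LHS]mx11_scalar mxE.
have fd : f *m delta_mx i 0 = 1%:M :> 'M_1.
  by rewrite mul_delta_mx; apply/matrixP => a b; rewrite !ord1 !mxE eqxx.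
have fx : f *m x = (w i 0 - 1)%:M by rewrite mulmxBr fw fd raddfB.
pose T : 'M[R]_n.+1 := tperm_mx 0 i.
have TT : T *m T = 1%:M by rewrite -perm_mxM tperm2 perm_mx1.
have E1 : T *m e1 R n.+1 = delta_mx i 0.
  apply/matrixP => a b; rewrite -row_permE !mxE ord1 eqxx andbT; congr (nat_of_bool _)%:R.
  by rewrite -[RHS](inj_eq (@perm_inj _ (tperm 0 i))) tpermR.
pose N := x *m f.
have NN : N *m N = (w i 0 - 1) *: N.
  by rewrite /N mulmxA -[x *m f *m x]mulmxA fx mul_mx_scalar scalemxAl.
have inv1 : (1%:M + N) *m (1%:M - y *: N) = 1%:M.
  rewrite mulmxDl mul1mx mulmxBr mulmx1 -scalemxAr NN scalerA -addrA.
  rewrite [X in _ + X](_ : _ = 0) ?addr0 // addrCA -scaleNr.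
  rewrite -[X in X + _]scale1r -!scaleNr -!scalerDl.
  by rewrite mulrBr yw mulr1 opprB addKr subrr scale0r.
have inv2 : (1%:M - y *: N) *m (1%:M + N) = 1%:M.
  exact: mulmx1C.
have fS : mxdef S f.
  by move=> a b; rewrite mxE; case: andP => _; [apply: defover1 | apply: defover0].
have NS : mxdef S N.
  apply: mxdefM fS => a b; rewrite ord1 !mxE; apply: defoverB => //.
  by case: andP => _; [apply: defover1 | apply: defover0].
have TS : mxdef S T.
  by move=> a b; rewrite !mxE; case: eqP => _; [apply: defover1 | apply: defover0].
exists ((1%:M + N) *m T), (T *m (1%:M - y *: N)); split.
- by rewrite mulmxA -[_ *m T *m T]mulmxA TT mulmx1.
- by rewrite mulmxA -[T *m _ *m _]mulmxA inv2 mulmx1.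
- by rewrite -mulmxA E1 mulmxDl mul1mx -mulmxA fd mulmx1 addrC subrK.
- apply: mxdefM TS => a b; rewrite mxE; apply: defoverD; last exact: NS.
  exact: (mxdef1 S).
apply: (mxdefM TS) => a b; rewrite [X in def _ X]mxE [X in def _ (_ + X)]mxE.
apply: defoverB; first exact: (mxdef1 S).
by rewrite mxE; apply: defoverM => //; apply: NS.
Qed.

(** The first row of H is left undetermined and b is reserved for it. Write the first column below
    the corner as t^a w with w = V e1; the inductive P fixes e1, so conjugation by the block matrix
    of 1 and [V *m P] turns this column into t^a e1. *)
Lemma hessenberg_form n (A : 'M[R]_n) :
  exists S (P Q H : 'M[R]_n) (b : nat),
    [/\ [/\ P *m Q = 1%:M, Q *m P = 1%:M & P *m e1 R n = e1 R n], A = P *m H *m Q,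
        [/\ mxdef S P, mxdef S Q & forall i j : 'I_n, (0 < i)%N -> def S (H i j)],
        hess t b H & (size S + b <= n * n.-1 * M)%N].
Proof.
elim: n A => [|n IHn] A.
  exists [::], 1%:M, 1%:M, A, 0%N; split; rewrite ?mulmx1 ?mul1mx //.
  by split; [exact: mxdef1 | exact: mxdef1 | case].
have := @submxK _ 1 n 1 n A; set al := ulsubmx _; set rho := ursubmx _.
set u := dlsubmx _; set B := drsubmx _ => eqA.
have [a [S1 [w [le_aM uE szS1 wS1 unitw]]]] := column_content iota h_surj h_ker u M_gt0.
have [V [W [VW WV Ve VS WS]]] := complete_column wS1 unitw.
have [S2 [P [Q [H [b [[PQ QP Pe] BE [PS QS HS] Hb szS2]]]]]] := IHn (W *m B *m V).
(* The first row of the inner H is not the first row of the larger matrix, so it is paid for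
   here. *)
have [S3 szS3 S3H] : exists2 S3, (size S3 <= n * M)%N &
    forall i j : 'I_n, (i == 0%N :> nat) -> def S3 (H i j).
  case: (posnP n) => [n0|n_gt0].
    exists [::] => // i; have := ltn_ord i; by rewrite [X in (_ < X)%N]n0.
  have [S3] := defover_collect (fun j => defover_any iota h_surj h_ker (H (Ordinal n_gt0) j)).
  rewrite card_ord => szS3 HS3; exists S3 => // i j /eqP i0.
  by rewrite (_ : i = Ordinal n_gt0) //; apply: val_inj.
pose S := S1 ++ S2 ++ S3.
have sS1 : {subset S1 <= S} by move=> y yS; rewrite !mem_cat yS.
have sS2 : {subset S2 <= S} by move=> y yS; rewrite !mem_cat yS orbT.
have sS3 : {subset S3 <= S} by move=> y yS; rewrite !mem_cat yS !orbT.
have HS' : mxdef S H.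
  move=> i j; case: (posnP i) => [i0|i_gt0]; last exact: (defover_sub sS2 (HS _ _ i_gt0)).
  by apply: (defover_sub sS3); apply: S3H; apply/eqP.
pose VP := V *m P; pose QW := Q *m W.
have VPS : mxdef S VP by apply: mxdefM; [apply: mxdef_sub VS | apply: mxdef_sub PS].
have QWS : mxdef S QW by apply: mxdefM; [apply: mxdef_sub QS | apply: mxdef_sub WS].
have VPQW : VP *m QW = 1%:M by rewrite mulmxA -[VP *m Q]mulmxA PQ mulmx1.
have QWVP : QW *m VP = 1%:M by rewrite mulmxA -[QW *m V]mulmxA WV mulmx1.
pose Pb := block_mx 1%:M 0 0 VP : 'M_(1 + n).
pose Qb := block_mx 1%:M 0 0 QW : 'M_(1 + n).
pose Hb' := block_mx al (rho *m VP) (t ^+ a *: e1 R n) H : 'M_(1 + n).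
have PQb : Pb *m Qb = 1%:M.
  by rewrite mulmx_block !mul1mx !mulmx0 !mul0mx !addr0 add0r VPQW -scalar_mx_block.
have QPb : Qb *m Pb = 1%:M.
  by rewrite mulmx_block !mul1mx !mulmx0 !mul0mx !addr0 add0r QWVP -scalar_mx_block.
have Pbe : Pb *m col_mx (1%:M : 'M_1) 0 = col_mx 1%:M 0.
  by rewrite mul_block_col !mulmx0 mul1mx mul0mx !addr0.
have eqPb : A = Pb *m Hb' *m Qb.
  rewrite -eqA !mulmx_block !mul1mx !mulmx0 !mul0mx !mulmx1 !addr0 !add0r.
  rewrite -[rho *m VP *m QW]mulmxA VPQW mulmx1; apply: (f_equal2 (block_mx al rho)).
    by rewrite uE -scalemxAr -mulmxA Pe Ve.
  rewrite /VP /QW -!mulmxA [H *m _]mulmxA [P *m (_ *m _)]mulmxA [P *m _]mulmxA -BE.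
  by rewrite -!mulmxA VW mulmx1 mulmxA VW mul1mx.
exists S, Pb, Qb, Hb', (n * a + b)%N; split; [split=> // | by [] | split | |].
- by rewrite e1S.
- exact: (mxdef_block (@mxdef1 S 1) (@mxdef0 S 1 n) (@mxdef0 S n 1) VPS).
- exact: (mxdef_block (@mxdef1 S 1) (@mxdef0 S 1 n) (@mxdef0 S n 1) QWS).
- move=> i j; rewrite !mxE; case: splitP => i' ->; first by rewrite ord1.
  move=> _; rewrite mxE; case: splitP => j' _ //; rewrite !mxE; apply: defoverM.
    by apply/defoverXn/defovert.
  by case: eqP => _; [apply: defover1 | apply: defover0].
- by exists a, b, al, (rho *m VP), H.
(* The costs n (M - a) for w, n (n - 1) M for the inner form, n M for its first row and n a in the
   new b add up to (n + 1) n M. *)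
rewrite !size_cat; move: szS1 szS2 szS3 le_aM; case: (n) => [|n'] /=; nia.
Qed.

Lemma size_dot_adj_e1 n b (H : 'M[R]_n) (rho : 'rV[R]_n) : hess t b H ->
  (size ((map_mx polyC rho *m adj_e1 H) ord0 ord0) <= n)%N.
Proof.
move=> /size_adj_e1 szH; rewrite mxE (leq_trans (size_sum _ _ _)) //.
apply/bigmax_leqP => i _; rewrite mxE mul_polyC.
exact: leq_trans (size_scale_leq _ _) (szH i).
Qed.

Lemma dot_col_mx n (rho : 'rV[R]_(1 + n)) (u c : {poly R}) (v : 'cV_n) :
  (map_mx polyC rho *m col_mx u%:M (c *: v)) 0 0
  = (rho 0 0)%:P * u + c * (map_mx polyC (rsubmx rho) *m v) 0 0.
Proof.
rewrite -[in LHS](hsubmxK rho) map_row_mx mul_row_col -scalemxAr mxE [X in _ + X]mxE.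
congr (_ + _); rewrite mxE big_ord1 !mxE eqxx mulr1n; congr ((rho _ _)%:P * _).
exact: val_inj.
Qed.

(** The leading coefficient gives t^e times the first entry of rho, which costs e parameters. Once
    that entry is known its term is subtracted, and the tail satisfies the same condition for H'
    with e + a instead of e. *)
Lemma hess_row_def n b (H : 'M[R]_n) e S (rho : 'rV[R]_n) :
  hess t b H -> mxdef S H ->
  polydef S ((t ^+ e)%:P * (map_mx polyC rho *m adj_e1 H) 0 0) ->
  exists2 S', (size S' <= n * e + b)%N & mxdef (S ++ S') rho.
Proof.
elim: n b H e S rho => [|n IHn] b H e S rho.
  by move=> _ _ _; exists [::] => // i [].
case=> a [b' [al [rho' [H' [-> hessH' ->]]]]] HS.
have [_ ->] := hessenberg_char_poly al rho' (t ^+ a) H'.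
set r1 : 'rV_n := @rsubmx _ 1 1 n rho; set r0 := rho 0 0.
rewrite (_ : (_ *m _) 0 0 = r0%:P * char_poly H' +
    (t ^+ a)%:P * (map_mx polyC r1 *m adj_e1 H') 0 0); last exact: dot_col_mx.
set D := (_ *m _) 0 0 => GS.
have H'S : mxdef S H'.
  by move=> i j; have := HS (rshift 1 i) (rshift 1 j); rewrite (@block_mxEdr _ 1 n 1 n).
(* Coefficient of X^n: the characteristic polynomial of H' is monic of degree n and D has lower
   degree. *)
have r0S : def S (t ^+ e * r0).
  have := GS n; rewrite mulrDr coefD mulrA -polyCM coefCM mulrA -polyCM coefCM.
  rewrite [D`_n]nth_default ?mulr0 ?addr0; last exact: size_dot_adj_e1 hessH'.
  have /monicP := char_poly_monic H'.
  by rewrite lead_coefE size_char_poly /= => ->; rewrite mulr1.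
have [S1 szS1 r0S1] := defover_divXn h_surj h_ker r0S.
have sS : {subset S <= S ++ S1} by move=> y yS; rewrite mem_cat yS.
have [||S2 szS2 r1S2] := IHn b' H' (e + a)%N (S ++ S1) r1 hessH'.
- exact: mxdef_sub sS H'S.
- rewrite exprD polyCM -mulrA -/D.
  rewrite (_ : _ * (_ * D) = (t ^+ e)%:P * (r0%:P * char_poly H' + (t ^+ a)%:P * D)
      - (t ^+ e)%:P * (r0%:P * char_poly H')).
    apply/polydefD/polydefN; first by move=> i; apply: defover_sub (GS i).
    apply/polydefM; first by apply/polydefC/defoverXn/defovert.
    apply/polydefM; first exact: polydefC.
    by apply/polydef_char_poly/(mxdef_sub sS).
  by rewrite mulrDr addrC addrA addNr add0r.
exists (S1 ++ S2); first by rewrite size_cat; nia.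
rewrite catA => i j; rewrite !ord1; case: (unliftP 0 j) => [j' ->|->].
  have := r1S2 0 j'; rewrite mxE; congr (def _ (rho _ _)); exact: val_inj.
by apply: defover_sub r0S1 => y yS; rewrite mem_cat yS.
Qed.

(** In Hessenberg form the rows below the first are known over S. The vanishing trace determines the
    corner entry for free, and [hess_row_def] with e = a gives the rest of the first row for at most
    b more parameters. *)
Lemma char_poly_Xn_def n (A : 'M[R]_n) : char_poly A = 'X^n ->
  exists2 S, (size S <= n * n.-1 * M)%N & mxdef S A.
Proof.
move=> chiA; have [S [P [Q [H [b [[PQ QP _] eqA [PS QS HS] Hb szS]]]]]] := hessenberg_form A.
suff [S' szS' HS'] : exists2 S', (size S' <= b)%N & mxdef (S ++ S') H.
  exists (S ++ S'); first by rewrite size_cat; lia.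
  have sS : {subset S <= S ++ S'} by move=> y yS; rewrite mem_cat yS.
  by rewrite eqA; apply: mxdefM (mxdef_sub sS QS); apply: mxdefM (mxdef_sub sS PS) _.
have chiH : char_poly H = 'X^n by rewrite -chiA eqA char_poly_conj.
case: n => [|n] in A H P Q b S chiA chiH Hb HS szS {eqA PQ QP PS QS} *.
  by exists [::] => // -[].
case: Hb => a [b' [al [rho [H' [eqH hessH' eqb]]]]].
have [chi _] := hessenberg_char_poly al rho (t ^+ a) H'.
have H'S : mxdef S H'.
  move=> i j; have := HS (rshift 1 i) (rshift 1 j) isT.
  by rewrite eqH (@block_mxEdr _ 1 n 1 n).
have chiS := polydef_char_poly H'S.
set D := (_ *m _) 0 0 in chi.
(* The matrix has size n + 1, so X^n has coefficient 0 in its characteristic polynomial. *)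
have alS : def S (al 0 0).
  have := congr1 (fun p : {poly R} => p`_n) chi; rewrite -eqH chiH coefXn ltn_eqF //.
  rewrite coefB coefCM [D`_n]nth_default ?mulr0 ?subr0; last exact: size_dot_adj_e1 hessH'.
  rewrite mulrBl coefB coefCM; have /monicP := char_poly_monic H'.
  rewrite lead_coefE size_char_poly /= => ->; rewrite mulr1 => /esym/eqP.
  rewrite subr_eq0 => /eqP <-; exact: (polydefM (polydefXn S 1) chiS).
have DS : polydef S ((t ^+ a)%:P * D).
  have -> : (t ^+ a)%:P * D = ('X - (al 0 0)%:P) * char_poly H' - 'X^(n.+1).
    by rewrite -chiH eqH chi opprB addrC subrK.
  apply/polydefD/polydefN/polydefXn/polydefM => //.
  by apply/polydefD/polydefN/polydefC => //; apply: (polydefXn S 1).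
have [S' szS' rhoS'] := hess_row_def hessH' H'S DS.
exists S'; first by rewrite eqb.
have sS : {subset S <= S ++ S'} by move=> y yS; rewrite mem_cat yS.
have almS : mxdef (S ++ S') al.
  by move=> i j; rewrite !ord1; apply: defover_sub alS.
have e1S : mxdef (S ++ S') (t ^+ a *: e1 R n).
  move=> i j; rewrite !mxE; apply: defoverM; first by apply/defoverXn/defovert.
  by case: eqP => _; [apply: defover1 | apply: defover0].
rewrite eqH; exact: (mxdef_block almS rhoS' e1S (mxdef_sub sS H'S)).
Qed.

End HessenbergCount.

(** * Upper bound for chains over the jet ideal *)

(** The matrix X - A divides X^r - A^r = X^r, so by determinants chi_A divides X^(n r); being monic
    of degree n, it is X^n. *)
Lemma char_poly_nilpotent (K : fieldType) n (A : 'M[K]_n) r :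
  A ^+ r = 0 -> char_poly A = 'X^n.
Proof.
move=> Ar0; have : char_poly A %| ('X - 0%:P) ^+ (n * r).
  pose C := map_mx polyC A.
  have Cr0 : C ^+ r = 0.
    by rewrite /C -(rmorphXn (map_mx (@polyC K))) Ar0 raddf0.
  have comXC : GRing.comm ('X%:M : 'M_n) C by apply: esym; apply: scalar_mxC.
  have := subrXX_comm r comXC; rewrite Cr0 subr0 => /(congr1 determinant).
  rewrite det_mulmx -/(char_poly_mx A) -/(char_poly A) => eqd.
  rewrite subr0 mulnC exprM -det_scalar.
  have -> : (('X : {poly K}) ^+ r)%:M = ('X%:M : 'M_n) ^+ r.
    by elim: (r) => [|s IHs]; rewrite ?exprS ?scalar_mxM ?IHs.
  by rewrite eqd dvdp_mulIl.
case/dvdp_exp_XsubCP => j _; rewrite subr0 => eqX.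
have /eqP -> : char_poly A == 'X^j.
  by rewrite -eqp_monic ?char_poly_monic ?monicXn.
have /eqP := eqp_size eqX; rewrite size_char_poly size_polyXn eqSS => /eqP <-.
by [].
Qed.

Definition generic_mx (k : comNzRingType) n : 'M[{mpoly k[n * n]}]_n :=
  \matrix_(i, j) 'X_(mxvec_index i j).

Lemma map_generic_mx (k L : comNzRingType) n (f : {rmorphism k -> L}) (v : 'I_(n * n) -> L) :
  map_mx (mmap f v) (generic_mx k n) = \matrix_(i, j) v (mxvec_index i j).
Proof. by apply/matrixP => i j; rewrite !mxE mmapX mmap1U. Qed.

(** The upper bound uses the nilpotent cone through these n equations. *)
Lemma nilcone_char_poly (k : fieldType) n i : (i < n)%N ->
  nilcone_ideal (char_poly (generic_mx k n))`_i.
Proof.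
move=> lt_in K iota A [r Ar0]; rewrite -coef_map map_char_poly map_generic_mx.
rewrite (_ : \matrix_(_, _) _ = A); last by apply/matrixP => a b; rewrite !mxE mxvecE.
by rewrite (char_poly_nilpotent Ar0) coefXn ltn_eqF.
Qed.

Lemma gen_mmap (k K : fieldType) (iota : {rmorphism k -> K}) S N (v : 'I_N -> K) :
  (forall i, gen iota S (v i)) -> forall p, gen iota S (mmap iota v p).
Proof.
move=> vS p; apply: gen_sum => m _; apply: gen_mul; first exact: gen_const.
apply: (big_ind (gen iota S)) => [|x y|i _]; [exact: gen1 | exact: gen_mul|].
by elim: (m i) => [|r IHr]; rewrite ?exprS; [exact: gen1 | exact: gen_mul].
Qed.

Lemma coef_jet_arc (A : nzRingType) N m (v : 'I_(N * m.+1) -> A) i (s : 'I_m.+1) :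
  (jet_arc v i)`_s = v (mxvec_index i s).
Proof.
rewrite /jet_arc coef_sum (bigD1 s) //= coefCM coefXn eqxx mulr1 big1 ?addr0 // => j.
by rewrite coefCM coefXn eq_sym -val_eqE => /negPf /= ->; rewrite mulr0.
Qed.

(** A point of the jet scheme is a matrix over K[t]/(t^(m + 1)), and [nilcone_char_poly] makes its
    characteristic polynomial X^n there. *)
Lemma jet_nilcone_gen (k K : fieldType) (iota : {rmorphism k -> K}) n m
    (v : 'I_(n * n * m.+1) -> K) :
  (forall g, jet_ideal (@nilcone_ideal k n) m g -> mmap iota v g = 0) ->
  exists2 S, (size S <= n * n.-1 * m.+1)%N & forall i, gen iota S (v i).
Proof.
move=> /jet_idealP vJ; have [R [h [hS hK]]] := truncated_poly_ring K (ltn0Sn m).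
pose A : 'M[{poly K}]_n := \matrix_(i, j) jet_arc v (mxvec_index i j).
have chiA : char_poly (map_mx h A) = 'X^n.
  rewrite -map_char_poly; apply/polyP => i; rewrite coef_map coefXn /=.
  case: (ltngtP i n) => [lt_in|lt_ni|->].
  - apply/hK => s lt_sm; have := vJ _ (@nilcone_char_poly k n i lt_in).
    rewrite -coef_map map_char_poly map_generic_mx -/A => /polyP/(_ s).
    by rewrite coef_take_poly lt_sm coef0.
  - by rewrite nth_default ?rmorph0 // size_char_poly.
  have /monicP := char_poly_monic A; rewrite lead_coefE size_char_poly /= => ->.
  by rewrite rmorph1.
have [S szS AS] := char_poly_Xn_def iota (ltn0Sn m) hS hK chiA.
exists S => // l; case/mxvec_indexP: l => l s; case/mxvec_indexP: l => i j.
rewrite -coef_jet_arc; apply: (defover_coef hK) => //.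
by have := AS i j; rewrite !mxE.
Qed.

(** The hypothesis is applied to the generic point of V([P 0]), whose coordinates are the images of
    the variables in the residue field. *)
Lemma prime_chain_gens_bound (k : fieldType) N (I : {mpoly k[N]} -> Prop) d :
  (forall (K : fieldType) (iota : {rmorphism k -> K}) (v : 'I_N -> K),
     (forall g, I g -> mmap iota v g = 0) ->
     exists2 S, (size S <= d)%N & forall i, gen iota S (v i)) ->
  forall e P, prime_chain I e P -> (e <= d)%N.
Proof.
move=> Igen e P chP; have [prP IP _] := chP.
have [K [h hP]] := prime_ideal_field (prP 0%N isT).
pose iota : {rmorphism k -> K} := h \o @mpolyC N k.
have hE g : h g = mmap iota (fun i => h 'X_i) g.
  rewrite [in LHS](mpolyE g) rmorph_sum; apply: eq_bigr => m _.
  rewrite -mul_mpolyC rmorphM mpolyXE_id rmorph_prod; congr (_ * _).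
  by apply: eq_bigr => i _; rewrite rmorphXn.
have [|S szS vS] := Igen K iota (fun i => h 'X_i).
  by move=> g Ig; rewrite -hE; apply/hP/IP.
apply: leq_trans szS; apply: (prime_chain_gen_bound (c := @mpolyC N k) chP hP) => x.
by rewrite hE; apply: gen_mmap.
Qed.

(** Descent on the bound d; whether a chain of length d exists is decided by excluded middle. *)
Lemma bounded_krull_dim (R : comNzRingType) (I : R -> Prop) d :
  (exists P, prime_chain I 0 P) ->
  (forall e P, prime_chain I e P -> (e <= d)%N) ->
  exists2 e, has_krull_dim I e & (e <= d)%N.
Proof.
move=> ch0; elim: d => [|d IHd] maxd; first by exists 0%N.
have [[P chP]|noP] := classic (exists P, prime_chain I d.+1 P).
  by exists d.+1 => //; split=> //; exists P.
have [e P chP|e dime /leqW] := IHd; last by exists e.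
have := maxd e P chP; rewrite leq_eqVlt ltnS => /orP[/eqP eqe|//].
by case: noP; exists P; rewrite -eqe.
Qed.

(** * A chain of length n(n-1) over the nilpotent cone *)

Lemma conjmxX (R : comNzRingType) n (P Q H : 'M[R]_n) r :
  P *m Q = 1%:M -> Q *m P = 1%:M -> (P *m H *m Q) ^+ r = P *m H ^+ r *m Q.
Proof.
move=> PQ QP; elim: r => [|r IHr]; first by rewrite !expr0 mulmx1.
rewrite exprS IHr [in RHS]exprS.
change (P *m H *m Q *m (P *m H ^+ r *m Q) = P *m (H *m H ^+ r) *m Q).
by rewrite !mulmxA -[P *m H *m Q *m P]mulmxA QP mulmx1.
Qed.

Lemma char_poly_ublock (R : comNzRingType) m n (A : 'M[R]_m) (B : 'M[R]_(m, n)) (D : 'M[R]_n) :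
  char_poly (block_mx A B 0 D) = char_poly A * char_poly D.
Proof.
rewrite /char_poly /char_poly_mx scalar_mx_block map_block_mx opp_block_mx add_block_mx.
by rewrite map_mx0 subr0 det_ublock.
Qed.

Section NilpotentParametrization.

Variable R : comNzRingType.
Implicit Types par : nat -> R.

(** Size n + 1 consumes n parameters for y, then n for w, and passes those from index 2 n on to the
    smaller matrix; size n uses n (n - 1) in all. *)
Definition col_par n par : 'cV[R]_n := \col_i par i.
Definition row_par n par : 'rV[R]_n := \row_i par (n + i)%N.

(* g (0, w; 0, B) g^-1 with g = (1, 0; y, 1): see nilmx_conj. *)
Fixpoint nilmx n par : 'M[R]_n :=
  if n is n'.+1 then
    let y := col_par n' par in let w := row_par n' par in
    let B := nilmx n' (fun i => par (2 * n' + i)%N) + y *m w in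
    block_mx (- (w *m y)) w (- (B *m y)) B : 'M_(1 + n')
  else 0.

Definition ushift n (y : 'cV[R]_n) : 'M[R]_(1 + n) := block_mx 1%:M 0 y 1%:M.

Lemma ushiftN n (y : 'cV[R]_n) : ushift y *m ushift (- y) = 1%:M.
Proof.
rewrite mulmx_block !mulmx0 !mul0mx !mulmx1 !mul1mx !addr0 !add0r subrr.
by rewrite -scalar_mx_block.
Qed.

Lemma ushift_conj n (y : 'cV[R]_n) (w : 'rV[R]_n) (B : 'M[R]_n) :
  ushift y *m block_mx 0 w 0 B *m ushift (- y) =
  block_mx (- (w *m y)) w (- ((B + y *m w) *m y)) (B + y *m w).
Proof.
rewrite !mulmx_block !mulmx0 !mul0mx !mulmx1 !mul1mx !addr0 !add0r.
by rewrite !mulmxN [_ + y *m _]addrC.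
Qed.

Lemma nilmx_conj n par : let y := col_par n par in
  nilmx n.+1 par = ushift y *m
    block_mx 0 (row_par n par) 0 (nilmx n (fun i => par (2 * n + i)%N)) *m ushift (- y).
Proof. exact/esym/ushift_conj. Qed.

Lemma char_poly_nilmx n par : char_poly (nilmx n par) = 'X^n.
Proof.
elim: n par => [|n IHn] par; first by rewrite /char_poly det_mx00.
rewrite nilmx_conj char_poly_conj ?ushiftN //.
apply: etrans (char_poly_ublock (0 : 'M_1) _ _) _.
by rewrite IHn {1}/char_poly det_mx11 !mxE subr0 exprS.
Qed.

Lemma nilmx_nilpotent n par : (0 < n)%N -> nilmx n par ^+ n = 0.
Proof.
case: n => // n _; have := Cayley_Hamilton (nilmx n.+1 par).
by rewrite char_poly_nilmx rmorphXn /= horner_mx_X.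
Qed.

Lemma block_mxX n (w : 'rV[R]_n) (B : 'M[R]_n) r :
  (block_mx (0 : 'M_1) w 0 B) ^+ r.+1 = block_mx 0 (w *m B ^+ r) 0 (B ^+ r.+1).
Proof.
elim: r => [|r IHr]; first by rewrite !expr1 expr0 mulmx1.
rewrite exprSr IHr; apply: etrans (mulmx_block _ _ _ _ _ _ _ _) _.
by rewrite !mulmx0 !mul0mx !addr0 !add0r -mulmxA [B ^+ r.+2]exprSr [B ^+ r.+1]exprSr.
Qed.

Lemma nilmxX n par : (0 < n)%N -> let y := col_par n par in
  let w := row_par n par *m nilmx n (fun i => par (2 * n + i)%N) ^+ n.-1 in
  nilmx n.+1 par ^+ n = block_mx (- (w *m y)) w (- (y *m w *m y)) (y *m w).
Proof.
case: n => // n _ y w; rewrite nilmx_conj conjmxX; first last.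
- by have := ushiftN (- y); rewrite opprK.
- exact: ushiftN.
rewrite block_mxX nilmx_nilpotent // -/w.
by apply: etrans (ushift_conj _ _ _) _; rewrite add0r.
Qed.

Lemma eq_nilmx n par par' : (forall i, (i < n * n.-1)%N -> par i = par' i) ->
  nilmx n par = nilmx n par'.
Proof.
elim: n par par' => //= n IHn par par' eqp.
have -> : col_par n par = col_par n par'.
  by apply/colP => i; rewrite !mxE eqp //; have := ltn_ord i; nia.
have -> : row_par n par = row_par n par'.
  by apply/rowP => i; rewrite !mxE eqp //; have := ltn_ord i; nia.
rewrite (IHn _ (fun i => par' (2 * n + i)%N)) // => i lt_i; apply: eqp.
by case: n lt_i {IHn} => [|n] //=; nia.
Qed.

(* nilmx n (shift_par n) is the nilpotent Jordan block. *)
Fixpoint shift_par n (i : nat) : R :=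
  if n is n'.+1 then
    if (i < 2 * n')%N then (i == n')%:R else shift_par n' (i - 2 * n')
  else 0.

(** For a Jordan block J of size n + 1 the first row of J^n is the last basis row. Only the indices
    from n + 1 on are prescribed, so the outermost y stays free. *)
Lemma nilmx_shift_last n par :
  (forall i, (n.+1 <= i)%N -> par i = shift_par n.+2 i) ->
  (row_par n.+1 par *m nilmx n.+1 (fun i => par (2 * n.+1 + i)%N) ^+ n) 0 ord_max = 1.
Proof.
have rowE m q : (forall i, (m.+1 <= i)%N -> q i = shift_par m.+2 i) ->
    row_par m.+1 q = delta_mx 0 0.
  move=> qE; apply/rowP => i; rewrite !mxE qE ?leq_addr //.
  rewrite [LHS]/= ifT; last by have := ltn_ord i; lia.
  by rewrite -[X in (_ == X)%N]addn0 eqn_add2l.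
elim: n par => [|n IHn] par parE; set par' := (fun i => _).
  by rewrite rowE // -matrix.rowE mxE expr0 mxE.
rewrite rowE // -matrix.rowE mxE.
have par'E i : par' i = shift_par n.+2 i.
  rewrite /par' parE; last by lia.
  by rewrite [LHS]/= ltnNge leq_addr /= addKn.
rewrite (nilmxX par' (ltn0Sn n)).
have -> : ord_max = rshift 1 (ord_max : 'I_n.+1) :> 'I_(1 + n.+1) by apply: val_inj.
have -> : 0 = lshift n.+1 (0 : 'I_1) :> 'I_(1 + n.+1) by apply: val_inj.
by apply: etrans (block_mxEur _ _ _ _ _ _) _; apply: IHn.
Qed.

End NilpotentParametrization.

(* Polynomials in the entries of an n x n matrix, as functions over all rings:
   such an F is recovered from its value at the generic matrix. *)
Definition natural_entry n (F : forall R : comNzRingType, 'M[R]_n -> R) :=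
  forall (R S : comNzRingType) (h : {rmorphism R -> S}) (A : 'M[R]_n),
    F S (map_mx h A) = h (F R A).

Lemma map_nilmx (R S : comNzRingType) (h : {rmorphism R -> S}) n (par : nat -> R) :
  map_mx h (nilmx n par) = nilmx n (h \o par).
Proof.
elim: n par => [|n IHn] par; first by apply/matrixP => -[].
have colE : map_mx h (col_par n par) = col_par n (h \o par) by apply/colP => i; rewrite !mxE.
have rowE : map_mx h (row_par n par) = row_par n (h \o par) by apply/rowP => i; rewrite !mxE.
refine (etrans (@map_block_mx _ _ h 1 n 1 n _ _ _ _) _).
by rewrite !(map_mxN, map_mxM, map_mxD) IHn colE rowE.
Qed.

(* For A = nilmx n.+1 par, the entry (s, last) of the lower right block of A ^+ n
   is y_s times a factor independent of y, and w is a block of A itself. *)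
Lemma nilmx_witness n s : (s < n * n.-1)%N ->
  exists2 F : forall R : comNzRingType, 'M[R]_n -> R, natural_entry F
  & (forall (R : comNzRingType) (par : nat -> R),
        (forall j, (j <= s)%N -> par j = 0) -> F R (nilmx n par) = 0) /\
    (forall R : comNzRingType, exists par : nat -> R,
        (forall j, (j < s)%N -> par j = 0) /\ F R (nilmx n par) = 1).
Proof.
elim: n s => //= n IHn s lt_s; have [lt_sn|le_ns] := ltnP s n.
  case: n lt_sn {lt_s IHn} => // n lt_sn; pose i0 := Ordinal lt_sn.
  exists (fun (R : comNzRingType) (A : 'M[R]_(1 + n.+1)) =>
    (A ^+ n.+1 : 'M[R]_(1 + n.+1)) (rshift 1 i0) (rshift 1 ord_max)).
    by move=> R S h A; rewrite -rmorphXn mxE.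
  split=> [R par par0|R].
    rewrite nilmxX // (@block_mxEdr _ 1 n.+1 1 n.+1) mxE big_ord1 mxE par0 ?mul0r //.
  (* The Jordan values make the factor beside y_s equal to 1, and y_s itself is set to 1. *)
  exists (fun i => if i == s then 1 else shift_par R n.+2 i).
  split=> [j lt_js|]; first by rewrite ltn_eqF //= ifT ?ltn_eqF //; lia.
  rewrite nilmxX // (@block_mxEdr _ 1 n.+1 1 n.+1) mxE big_ord1 mxE /= eqxx mul1r.
  by apply: nilmx_shift_last => i le_i; rewrite gtn_eqF //; lia.
have [lt_s2|le_2s] := ltnP s (2 * n).
  have lt_sn : (s - n < n)%N by lia.
  pose j0 := Ordinal lt_sn.
  exists (fun (R : comNzRingType) (A : 'M[R]_(1 + n)) => A (lshift n 0) (rshift 1 j0)).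
    by move=> R S h A; rewrite mxE.
  split=> [R par par0|R].
    by rewrite block_mxEur mxE par0 //= subnKC.
  exists (fun i => (i == s)%:R); split=> [j lt_js|]; first by rewrite ltn_eqF.
  by rewrite block_mxEur mxE /= subnKC // eqxx.
have [F natF [F0 F1]] := IHn (s - 2 * n)%N ltac:(case: (n) lt_s le_2s => [|n'] /=; nia).
exists (fun (R : comNzRingType) (A : 'M[R]_(1 + n)) => F R (drsubmx A)).
  by move=> R S h A; rewrite -natF map_drsubmx.
(* For s at least 2 n both claims have y = 0, which reduces them to the smaller matrix and s - 2
   n. *)
have dr (R : comNzRingType) (par : nat -> R) : (forall j, (j < n)%N -> par j = 0) ->
    drsubmx (nilmx n.+1 par : 'M_(1 + n)) = nilmx n (fun i => par (2 * n + i)%N).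
  move=> par0; apply: etrans (block_mxKdr _ _ _ _) _.
  rewrite (_ : col_par n par = 0) ?mul0mx ?addr0 //.
  by apply/colP => i; rewrite !mxE par0.
split=> [R par par0|R].
  rewrite dr; last by move=> j lt_jn; apply: par0; lia.
  by apply: F0 => j le_j; apply: par0; lia.
have [par [par0 parF]] := F1 R.
exists (fun i => if (i < 2 * n)%N then 0 else par (i - 2 * n)%N); split=> [j lt_js|].
  by case: ltnP => // le_2j; apply: par0; lia.
rewrite dr; last by move=> j lt_jn; rewrite ifT //; lia.
rewrite -[RHS]parF; congr (F R _); apply: eq_nilmx => i _.
by rewrite ltnNge leq_addr /= addKn.
Qed.

Lemma rmorph_mmap (k A B : comNzRingType) (iota : {rmorphism k -> A}) (h : {rmorphism A -> B})
    N (v : 'I_N -> A) (p : {mpoly k[N]}) :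
  h (mmap iota v p) = mmap (h \o iota) (h \o v) p.
Proof.
rewrite /mmap rmorph_sum; apply: eq_bigr => m _; rewrite rmorphM; congr (_ * _).
by rewrite /mmap1 rmorph_prod; apply: eq_bigr => i _; rewrite rmorphXn.
Qed.

Lemma eq_mmap (k A : comNzRingType) (f f' : k -> A) N (v v' : 'I_N -> A) (p : {mpoly k[N]}) :
  f =1 f' -> v =1 v' -> mmap f v p = mmap f' v' p.
Proof.
move=> ff' vv'; apply: eq_bigr => m _; rewrite ff'; congr (_ * _).
by apply: eq_bigr => i _; rewrite vv'.
Qed.

Definition rker (R D : nzRingType) (h : {rmorphism R -> D}) : {pred R} := fun x => h x == 0.

Lemma mem_rker (R D : nzRingType) (h : {rmorphism R -> D}) x : (x \in rker h) = (h x == 0).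
Proof. by []. Qed.

Lemma rker_prime_ideal (R : nzRingType) (D : idomainType) (h : {rmorphism R -> D}) :
  is_prime_ideal (rker h).
Proof.
split; first split.
- by rewrite mem_rker rmorph0.
- by rewrite mem_rker rmorph1 oner_eq0.
- by move=> a x y; rewrite !mem_rker rmorphD rmorphM => /eqP-> /eqP->; rewrite mulr0 addr0.
by move=> x y; rewrite !mem_rker rmorphM mulf_eq0.
Qed.

(** The s-th prime is the kernel of evaluation at the generic [nilmx] whose first s parameters are
    0. Specialization gives the inclusions and [nilmx_witness] their strictness. *)
Lemma nilcone_chain (k : fieldType) n : (0 < n)%N ->
  exists P, prime_chain (@nilcone_ideal k n) (n * n.-1) P.
Proof.
move=> n_gt0; set D := (n * n.-1)%N; pose T := {mpoly k[D]}.
pose par (s j : nat) : T :=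
  if insub j is Some i then if (s <= j)%N then 'X_(i : 'I_D) else 0 else 0.
have par0 s j : (j < s)%N -> par s j = 0.
  by rewrite /par ltnNge => /negPf->; case: insub.
pose ev s : {rmorphism {mpoly k[n * n]} -> T} :=
  mmap (@mpolyC D k) (fun l => mxvec (nilmx n (par s)) 0 l).
have evE s F : natural_entry F -> ev s (F _ (generic_mx k n)) = F _ (nilmx n (par s)).
  move=> natF; rewrite -natF map_generic_mx; congr (F _ _).
  by apply/matrixP => i j; rewrite mxE mxvecE.
exists (fun s => rker (ev s)); split=> [s _|s f _ If|s lt_sD].
- exact: rker_prime_ideal.
(* Membership in [nilcone_ideal] is tested over fields, hence the passage from T to
   [{fraction T}]. *)
- rewrite mem_rker -tofrac_eq0; apply/eqP.
  pose A : 'M[{fraction T}]_n := map_mx (@tofrac T) (nilmx n (par s)).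
  rewrite rmorph_mmap -[RHS](If {fraction T} (@tofrac T \o @mpolyC D k) A).
    by apply: eq_mmap => // l /=; case/mxvec_indexP: l => i j; rewrite !mxvecE mxE.
  by exists n; rewrite -rmorphXn nilmx_nilpotent // raddf0.
have [F natF [F0 F1]] := nilmx_witness lt_sD.
(* The specialization that sets the s-th parameter to 0. *)
pose sigma : {rmorphism T -> T} :=
  mmap (@mpolyC D k) (fun i : 'I_D => if i == s :> nat then 0 else 'X_i).
have sigma_par j : sigma (par s j) = par s.+1 j.
  rewrite /par; case: insubP => [i lt_j ij|_]; last exact: rmorph0.
  rewrite [(s <= j)%N]leq_eqVlt; case: ltnP => [lt_sj|le_js].
    by rewrite orbT /= /sigma /= mmapX mmap1U ij gtn_eqF.
  rewrite orbF; case: eqP => [sj|_]; last exact: rmorph0.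
  by rewrite /sigma /= mmapX mmap1U ij sj eqxx.
have sigma_nilmx : nilmx n (par s.+1) = map_mx sigma (nilmx n (par s)).
  by rewrite map_nilmx; apply: eq_nilmx => j _; rewrite -sigma_par.
have evS f : ev s f = 0 -> ev s.+1 f = 0.
  move=> f0; rewrite -(rmorph0 sigma) -f0 rmorph_mmap; apply: eq_mmap => [c|l] /=.
    by rewrite mmapC.
  by case/mxvec_indexP: l => i j; rewrite !mxvecE sigma_nilmx mxE.
split=> [f /eqP/evS/eqP //|].
exists (F _ (generic_mx k n)).
  by rewrite mem_rker evE // F0 // => j le_js; apply: par0.
(* The witness takes the value 1 at the k-point q of the s-th family, so it is nonzero on the
   generic member. *)
have [q [q0 Fq]] := F1 k.
pose eval : {rmorphism T -> k} := mmap idfun (fun i : 'I_D => q i).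
have eval_nilmx : map_mx eval (nilmx n (par s)) = nilmx n q.
  rewrite map_nilmx; apply: eq_nilmx => j lt_jD.
  rewrite /par /= insubT /=; case: leqP => [_|lt_js]; last by rewrite rmorph0 q0.
  by rewrite mmapX mmap1U.
rewrite mem_rker evE //; apply: contra_eq_neq Fq => F_0.
by rewrite -eval_nilmx natF F_0 rmorph0 eq_sym oner_neq0.
Qed.

Theorem theoremA (k : finFieldType) (n : nat) (hn : (1 <= n)%N) :
  exists (dN C0 : nat),
    has_krull_dim (@nilcone_ideal k n) dN /\
    forall m : nat, exists dJ : nat,
      has_krull_dim (jet_ideal (@nilcone_ideal k n) m) dJ /\
      (dJ < m * dN + C0)%N.
Proof.
have [P chP] := nilcone_chain k hn.
(* The crude bound n^2, the number of coordinates, makes the dimension exist; the chain then bounds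
   it below. *)
have [||dN dimN _] := @bounded_krull_dim _ (@nilcone_ideal k n) (n * n).
- case: chP => prP IP _; exists (fun=> P 0%N).
  by split=> // [i _|i f _]; [exact: prP | exact: (IP 0%N)].
- apply: prime_chain_gens_bound => K iota v _; exists (codom v).
    by rewrite size_codom card_ord.
  by move=> i; apply: gen_mem; apply: codom_f.
have le_dN : (n * n.-1 <= dN)%N by case: dimN => _ /(_ _ _ chP).
(* With this constant, dJ <= n (n - 1) (m + 1) and n (n - 1) <= dN give the strict inequality. *)
exists dN, (n * n.-1).+1; split=> // m.
have [||dJ dimJ le_dJ] :=
  @bounded_krull_dim _ (jet_ideal (@nilcone_ideal k n) m) (n * n.-1 * m.+1).
(* The zero arc is a k-point of the jet scheme, so the kernel of evaluation there is a chain of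
   length 0. *)
- pose h : {rmorphism {mpoly k[n * n * m.+1]} -> k} := mmap idfun (fun=> 0).
  exists (fun=> rker h); split=> // [i _|i f _ If].
    exact: rker_prime_ideal.
  rewrite mem_rker; apply/eqP; move: f If; apply/jet_idealP => f If {i}.
  have arc0 i : jet_arc (fun=> 0 : k) i = 0 :> {poly k}.
    by apply: big1 => s _; rewrite mul0r.
  have A0 : exists r, (0 : 'M[k]_n) ^+ r = 0 by exists 1%N; rewrite expr1.
  have f0 := If k idfun 0 A0.
  rewrite (_ : mmap _ _ f = (mmap idfun (fun l => mxvec (0 : 'M[k]_n) 0 l) f)%:P).
    by rewrite f0 raddf0.
  rewrite rmorph_mmap; apply: eq_mmap => //= l.
  by rewrite arc0 /= (linear0 mxvec) mxE polyC0.
- by apply: prime_chain_gens_bound => K iota v; apply: jet_nilcone_gen.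
exists dJ; split=> //; nia.
Qed.
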